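(* Let $\mu=\prod_{i=1}^\infty\nu_i$ be a product probability measure on $[0,1]^{\mathbb{N}}$ and, for each $i$, let $m_i:=\int_{[0,1]}x\,d\nu_i(x)$, $m_i^{(2)}:=\int_{[0,1]}x^2\,d\nu_i(x)$ and $\epsilon_{1i}:=\nu_i(\{1\})$. Suppose $$\limsup_{n\to\infty}\frac1{\sqrt n}\sum_{i=1}^n\left(m_i-\tfrac12\right)<\infty,\qquad \liminf_{n\to\infty}\frac1n\sum_{i=1}^n\left(m_i-m_i^{(2)}\right)>0,\qquad \limsup_{n\to\infty}\frac1n\sum_{i=1}^n\epsilon_{1i}<\frac12,$$ and that $\sigma_{T,n}:=\left(\sum_{i=1}^n\int_{[0,1]}(x-m_i)^2\,d\nu_i(x)\right)^{1/2}\to\infty$ as $n\to\infty$. Then $\mu(\mathcal{C}_I)=0$.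
   Context: For a sequence $(p_i)_{i=1}^\infty\in[0,1]^{\mathbb{N}}$ let $X_1,X_2,\dots$ be independent random variables with values in $\{0,1\}$ and $\mathbb{P}(X_i=1)=p_i$. The sequence satisfies the Condorcet Jury Property if $\lim_{n\to\infty,\ n\text{ odd}}\mathbb{P}\left(\sum_{i=1}^nX_i>\frac n2\right)=1$; $\mathcal{C}_I$ is the set of sequences satisfying it. *)

(* Defs.v *)
From HB Require Import structures.
From mathcomp Require Import all_boot all_order all_algebra.
From mathcomp Require Import all_classical all_reals all_analysis.
Set Implicit Arguments. Unset Strict Implicit. Unset Printing Implicit Defensive.
Import Order.TTheory GRing.Theory Num.Theory numFieldNormedType.Exports.
Local Open Scope classical_set_scope.
Local Open Scope ring_scope.

(* P(X_1 + ... + X_n > n/2) for independent Bernoulli X_i with P(X_i=1)=p_i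
   (indices shifted to 0-based: X_i for i < n), written out as the finite
   sum over all outcomes x in {0,1}^n. *)
Definition maj_prob (R : realType) (p : nat -> R) (n : nat) : R :=
  \sum_(x : {ffun 'I_n -> bool} | (n < 2 * \sum_(i < n) (x i : nat))%N)
     \prod_(i < n) (if x i then p (val i) else 1 - p (val i)).

Definition CJP (R : realType) : set (nat -> R) :=
  [set p : nat -> R | (forall i, 0 <= p i <= 1) /\
           maj_prob p (2 * k).+1 @[k --> \oo] --> (1 : R)].

Definition mutually_independent d (T : measurableType d) (R : realType)
  (P : probability T R) (Y : nat -> T -> R) : Prop :=
  forall (s : seq nat) (B : nat -> set R), uniq s ->
    (forall i, measurable (B i)) ->
    P (\bigcap_(i in [set j | j \in s]) (Y i @^-1` B i)) =
    (\prod_(i <- s) P (Y i @^-1` B i))%E.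

(* Main.v *)
Require Import Defs.
From HB Require Import structures.
From mathcomp Require Import all_boot all_order all_algebra.
From mathcomp Require Import all_classical all_reals all_analysis.
From mathcomp Require Import measurable_realfun ring lra zify.
Import Order.TTheory GRing.Theory Num.Theory numFieldNormedType.Exports.
Set Implicit Arguments. Unset Strict Implicit. Unset Printing Implicit Defensive.
Local Open Scope classical_set_scope.
Local Open Scope ring_scope.

(* If [sum (p_i - 1/2) <= K sqrt n] and [sum p_i (1 - p_i) >= c n], the majority
   is wrong with probability bounded below in terms of [K] and [c] only: tilting
   each [p_i] to [p_i - s p_i (1 - p_i)] with [s = t / sqrt n] and [t] large
   pushes the mean below [n / 2 - 2 sqrt n], so that the tilted majority is
   wrong with probability at least [3 / 4], while the tilted law has second
   moment at most [prod (1 + s^2 p_i (1 - p_i)) <= exp (t^2)] relative to the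
   original one. For the random [p_i = Y_i], Chebyshev's inequality shows that
   both conditions hold at each large [n] outside an event of probability at
   most [eps] (with [K] depending on [eps]). On [CJP] that exceptional event
   must occur for all large odd [n], hence [CJP] has probability at most [eps]. *)

(** * Bernoulli products: a Chernoff bound and a change of measure *)

Section bernoulli_product.
Context (R : realType).
Implicit Types (p : nat -> R).

Lemma sum_ffun_bool_prod n (F : 'I_n -> bool -> R) :
  \sum_(x : {ffun 'I_n -> bool}) \prod_(i < n) F i (x i) =
  \prod_(i < n) (F i true + F i false).
Proof.
by rewrite -bigA_distr_bigA; apply: eq_bigr => i _; rewrite big_bool.
Qed.

(** With [a] ones and [b] zeros, a majority means [a > b], and [u ^ a * v ^ b = (u * v) ^ b * u ^ (a
    - b)]. *)
Lemma prod_majority_ge1 n (u v : R) (x : {ffun 'I_n -> bool}) :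
  1 <= u -> 0 <= v -> 1 <= u * v -> (n < 2 * \sum_(i < n) (x i : nat))%N ->
  1 <= \prod_(i < n) (if x i then u else v).
Proof.
move=> u1 v0 uv1 maj.
have -> : \prod_(i < n) (if x i then u else v) =
    u ^+ (\sum_(i < n) (x i : nat)) * v ^+ (\sum_(i < n) (~~ x i : nat)).
  rewrite -!prodrXr -big_split /=; apply: eq_bigr => i _.
  by case: (x i); rewrite !(expr1, expr0, mulr1, mul1r).
have sumn : (\sum_(i < n) (x i : nat) + \sum_(i < n) (~~ x i : nat) = n)%N.
  rewrite -big_split /= -[RHS]card_ord -sum1_card; apply: eq_bigr => i _.
  by case: (x i).
set a := (\sum_(i < n) (x i : nat))%N in maj sumn *.
set b := (\sum_(i < n) _)%N in sumn *.
have -> : a = (b + (a - b))%N by lia.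
rewrite exprD mulrAC -exprMn.
by rewrite -[1]mulr1 ler_pM ?ler01 ?exprn_ege1.
Qed.

Lemma prod_1D_le_expR n (F : 'I_n -> R) : (forall i, 0 <= 1 + F i) ->
  \prod_(i < n) (1 + F i) <= expR (\sum_(i < n) F i).
Proof.
move=> F0; rewrite expR_sum; apply: ler_prod => i _.
by rewrite F0 expR_ge1Dx.
Qed.

Lemma outcome_prob_ge0 p n (x : {ffun 'I_n -> bool}) :
  (forall i, 0 <= p i <= 1) ->
  0 <= \prod_(i < n) (if x i then p i else 1 - p i).
Proof.
move=> p01; apply: prodr_ge0 => i _.
by case: (x i); have /andP[] := p01 i; rewrite ?subr_ge0.
Qed.

Lemma maj_prob_chernoff p n (l : R) : (forall i, 0 <= p i <= 1) -> 0 <= l ->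
  maj_prob p n <= expR (l * \sum_(i < n) (2 * p i - 1) + l ^+ 2 *+ n).
Proof.
(* Ones get weight [1 + l] and zeros get [v], a polynomial stand-in for the inverse of [1 + l]:
   since [(1 + l) * v = 1 + l ^ 3], majority outcomes have total weight at least 1. *)
move=> p01 l0; pose v := 1 - l + l ^+ 2.
have v0 : 0 <= v by rewrite /v; nra.
have uv1 : 1 <= (1 + l) * v.
  have l3 : 0 <= l ^+ 3 by rewrite exprn_ge0.
  by rewrite (_ : _ * v = 1 + l ^+ 3) ?lerDl // /v; ring.
apply: (@le_trans _ _ (\sum_(x : {ffun 'I_n -> bool})
    \prod_(i < n) (if x i then p i * (1 + l) else (1 - p i) * v))).
  rewrite /maj_prob big_mkcond; apply: ler_sum => x _.
  have -> : \prod_(i < n) (if x i then p i * (1 + l) else (1 - p i) * v) =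
      \prod_(i < n) (if x i then p i else 1 - p i) *
      \prod_(i < n) (if x i then 1 + l else v).
    by rewrite -big_split /=; apply: eq_bigr => i _; case: (x i).
  case: ifPn => maj.
    rewrite ler_peMr ?outcome_prob_ge0 ?prod_majority_ge1 //; lra.
  rewrite mulr_ge0 ?outcome_prob_ge0 //; apply: prodr_ge0 => i _.
  by case: (x i) => //; lra.
rewrite (sum_ffun_bool_prod (fun i b => if b then _ else _)).
pose F (i : 'I_n) := l * (2 * p i - 1) + (1 - p i) * l ^+ 2.
rewrite (eq_bigr (fun i => 1 + F i)); last by move=> i _; rewrite /F /v; ring.
apply: (le_trans (prod_1D_le_expR _)) => [i|].
  rewrite [X in 0 <= X](_ : _ = p i * (1 + l) + (1 - p i) * v).
    by have /andP[p0 p1] := p01 i; rewrite addr_ge0 // mulr_ge0 //; lra.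
  by rewrite /F /v; ring.
rewrite ler_expR mulr_sumr -[X in _ <= _ + _ *+ X]card_ord -sumr_const.
rewrite -big_split /= ler_sum // => i _; rewrite /F.
by have := p01 i; move: (p i) => q /andP[]; nra.
Qed.


Lemma maj_probE p n (A := fun x : {ffun 'I_n -> bool} =>
    (n < 2 * \sum_(i < n) (x i : nat))%N) :
  maj_prob p n = 1 - \sum_(x : {ffun 'I_n -> bool} | ~~ A x)
     \prod_(i < n) (if x i then p i else 1 - p i).
Proof.
have tot : \sum_(x : {ffun 'I_n -> bool})
    \prod_(i < n) (if x i then p i else 1 - p i) = 1.
  rewrite (sum_ffun_bool_prod (fun i b => if b then _ else _)) big1 // => i _.
  by rewrite addrC subrK.
move: tot; rewrite (bigID A) /= -[X in X + _]/(maj_prob p n) => /eqP.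
by rewrite eq_sym -subr_eq => /eqP <-.
Qed.

(** The law of [q] has density [h] relative to that of [p], with second moment at most [D].
    Integrating [h <= h ^ 2 / (4 D) + D] over the minority outcomes bounds their [q]-mass, at least
    [3 / 4], by [1 / 4] plus [D] times their [p]-mass. *)
Lemma maj_prob_tilt p n (s : R) (D : R) :
  (forall i, 0 <= p i <= 1) -> 0 < D ->
  \prod_(i < n) (1 + s ^+ 2 * (p i * (1 - p i))) <= D ->
  let q i := p i * (1 - s * (1 - p i)) in
  maj_prob q n <= 1 / 4 -> maj_prob p n <= 1 - (2 * D)^-1.
Proof.
move=> p01 D0 leD q; rewrite !maj_probE.
set A := fun x : {ffun 'I_n -> bool} => (n < 2 * \sum_(i < n) (x i : nat))%N.
pose w (x : {ffun 'I_n -> bool}) := \prod_(i < n) (if x i then p i else 1 - p i).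
pose h (x : {ffun 'I_n -> bool}) : R :=
  \prod_(i < n) (if x i then 1 - s * (1 - p i) else 1 + s * p i).
have w0 x : 0 <= w x by exact: outcome_prob_ge0.
have qE (x : {ffun 'I_n -> bool}) : \prod_(i < n) (if x i then q i else 1 - q i) = w x * h x.
  rewrite -big_split; apply: eq_bigr => i _; rewrite /q; case: (x i) => //=; ring.
rewrite (eq_bigr (fun x => w x * h x)); last by move=> x _; exact: qE.
rewrite -/(\sum_(x | ~~ A x) w x).
have h2 : \sum_x w x * h x ^+ 2 <= D.
  (* The second moment factorizes over coordinates; in each factor the terms linear in [s] cancel,
     leaving [1 + s ^ 2 * p i * (1 - p i)]. *)
  apply: le_trans leD; rewrite le_eqVlt; apply/orP; left; apply/eqP.
  pose F (i : 'I_n) (b : bool) := if b then p i * (1 - s * (1 - p i)) ^+ 2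
    else (1 - p i) * (1 + s * p i) ^+ 2.
  rewrite (eq_bigr (fun x : {ffun 'I_n -> bool} => \prod_(i < n) F i (x i))).
    rewrite sum_ffun_bool_prod; apply: eq_bigr => i _; rewrite /F; ring.
  move=> x _; rewrite -prodrXl -big_split; apply: eq_bigr => i _ /=.
  by rewrite /F; case: (x i).
have : \sum_(x | ~~ A x) w x * h x <=
    (4 * D)^-1 * (\sum_x w x * h x ^+ 2) + D * \sum_(x | ~~ A x) w x.
  rewrite [X in _ <= _ * X + _](bigID A) /= mulrDr -addrA.
  rewrite ler_wpDl//.
    apply: mulr_ge0; first by rewrite invr_ge0; lra.
    by apply: sumr_ge0 => x _; rewrite mulr_ge0 ?sqr_ge0.
  rewrite !mulr_sumr -big_split /= ler_sum // => x _.
  rewrite [X in _ <= _ + X]mulrC mulrCA -mulrDr ler_wpM2l //.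
  rewrite -subr_ge0 [X in 0 <= X](_ : _ = (4 * D)^-1 * (h x - 2 * D) ^+ 2).
    by rewrite mulr_ge0 ?sqr_ge0 ?invr_ge0; lra.
  by field; rewrite gt_eqF.
set S := \sum_(x | ~~ A x) w x => le1 le2.
have le3 : (4 * D)^-1 * (\sum_x w x * h x ^+ 2) <= 4^-1.
  rewrite invfM -mulrA ler_piMr ?invr_ge0// mulrC ler_pdivrMr// mul1r.
  exact: h2.
rewrite lerD2l lerN2 invfM ler_pdivrMr//.
by rewrite mulrC; lra.
Qed.

(* [2] is the margin, in units of [sqrt n], by which the tilted mean falls below
   [n / 2]; it makes Chernoff's bound [expR (- 4) <= 1 / 4]. *)
Lemma maj_prob_bounded_away p n (c K : R) (t := (K + 2) / c) :
  (forall i, 0 <= p i <= 1) -> 0 < c -> 0 <= K -> t <= Num.sqrt n%:R ->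
  \sum_(i < n) (p i - 2^-1) <= K * Num.sqrt n%:R ->
  c * n%:R <= \sum_(i < n) p i * (1 - p i) ->
  maj_prob p n <= 1 - (2 * expR (t ^+ 2))^-1.
Proof.
move=> p01 c0 K0 tn meanle varge.
have t0 : 0 < t by rewrite divr_gt0 //; lra.
set r := Num.sqrt n%:R in tn meanle *.
have r0 : 0 < r by lra.
have rr : r ^+ 2 = n%:R by rewrite sqr_sqrtr.
have rN0 : r != 0 by rewrite gt_eqF.
(* The hypothesis [t <= r] gives [s <= 1], which keeps the tilted parameters in the unit interval,
   as the Chernoff bound requires. *)
pose s := t / r.
have s0 : 0 <= s by rewrite divr_ge0 //; lra.
have s1 : s <= 1 by rewrite ler_pdivrMr // mul1r.
have ct : c * t = K + 2 by rewrite /t mulrC divfK // gt_eqF.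
apply: (@maj_prob_tilt p n s); rewrite ?expR_gt0 //.
  apply: (le_trans (prod_1D_le_expR _)) => [i|].
    have /andP[p0 p1] := p01 i.
    by rewrite addr_ge0 // mulr_ge0 ?sqr_ge0 // mulr_ge0 // subr_ge0.
  rewrite ler_expR; apply: (@le_trans _ _ (\sum_(i < n) s ^+ 2)).
    apply: ler_sum => i _; rewrite ler_piMr ?sqr_ge0 //.
    by have /andP[] := p01 i; move: (p i) => a; nra.
  by rewrite sumr_const card_ord -mulr_natr -rr /s -exprMn divfK.
have q01 i : 0 <= p i * (1 - s * (1 - p i)) <= 1.
  have /andP[] := p01 i; move: (p i) => a a0 a1.
  have : 0 <= s * (1 - a) by rewrite mulr_ge0 ?subr_ge0.
  have : s * (1 - a) <= 1 by nra.
  by move: (s * (1 - a)) => b *; apply/andP; split; nra.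
(* With [l = 2 / r] and a tilted sum of [2 q - 1] at most [- 4 r], the Chernoff exponent is at most
   [- 8 + 4 = - 4]. *)
have l0 : 0 <= 2 / r by rewrite divr_ge0 // ltW.
apply: (le_trans (maj_prob_chernoff _ q01 l0)).
apply: (@le_trans _ _ (expR (- 4))); last first.
  rewrite expRN -[4]mulr1 -div1r ler_pdivrMr ?expR_gt0 // mulr1.
  by have := @expR_ge1Dx R 4; lra.
rewrite ler_expR -[X in _ + X <= _]mulr_natr -rr -exprMn divfK //.
suff : \sum_(i < n) (2 * (p i * (1 - s * (1 - p i))) - 1) <= - 4 * r.
  move=> /(ler_wpM2l l0); rewrite mulrCA divfK //; lra.
have -> : \sum_(i < n) (2 * (p i * (1 - s * (1 - p i))) - 1) =
    2 * \sum_(i < n) (p i - 2^-1) - 2 * s * \sum_(i < n) p i * (1 - p i).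
  by rewrite !mulr_sumr -sumrB; apply: eq_bigr => i _; field.
have : s * (c * n%:R) = (K + 2) * r by rewrite -rr -ct /s; field.
by have := ler_wpM2l s0 varge; lra.
Qed.

End bernoulli_product.

(** * Second moments and deviations of sums of independent variables *)

Lemma bounded_integrable d (T : measurableType d) (R : realType)
    (P : probability T R) (f : T -> R) (M : R) :
  measurable_fun setT f -> (forall x, `|f x| <= M) ->
  P.-integrable setT (EFin \o f).
Proof.
move=> mf fM; apply: measurable_bounded_integrable => //.
  by apply: le_lt_trans (ltry 1); exact: probability_le1.
exists M; split; first exact: num_real.
by move=> x Mx y _; exact: (le_trans (fM y) (ltW Mx)).
Qed.

Section independent_sums.
Context (R : realType) (nu : nat -> probability R R)
  (d : measure_display) (T : measurableType d) (P : probability T R)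
  (Y : nat -> T -> R).
Hypothesis mY : forall i, measurable_fun setT (Y i).
Hypothesis lawY : forall i B, measurable B -> P (Y i @^-1` B) = nu i B.
Hypothesis indY : mutually_independent P Y.

(** Independence of the pair gives equality on rectangles, and a product measure is determined by
    its values there. *)
Lemma joint_law_prod i j X : i != j -> measurable X ->
  (nu i \x nu j)%E X = pushforward P (fun w => (Y i w, Y j w)) X.
Proof.
move=> ij mX.
have mphi : measurable_fun setT (fun w => (Y i w, Y j w)).
  exact: measurable_fun_pair.
pose phi : {mfun T >-> (R * R)%type} :=
  HB.pack (fun w => (Y i w, Y j w)) (isMeasurableFun.Build _ _ _ _ _ mphi).
apply: (@product_measure_unique _ _ _ _ _ (nu i) (nu j) (pushforward P phi)) => //.
move=> A B mA mB; rewrite /pushforward /=.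
have := @indY [:: i; j] (fun k => if k == i then A else B).
rewrite !big_cons big_nil mule1 /= inE ij eqxx eq_sym (negbTE ij) !lawY// => <- //.
  congr (P _); apply/seteqP; split=> w /=.
    move=> [Aw Bw] k /=; rewrite !inE => /orP[]/eqP ->; rewrite ?eqxx //.
    by rewrite eq_sym (negbTE ij).
  move=> H; split; first by have := H i; rewrite /= !inE !eqxx; exact.
  by have := H j; rewrite /= !inE !eqxx orbT eq_sym (negbTE ij); exact.
by move=> k; case: ifP.
Qed.

(** After transport to the product law, Fubini makes the inner integral, that of [g], vanish; [f]
    need not be centred. *)
Lemma integral_indep_prod i j (f g : R -> R) (M : R) : i != j ->
  measurable_fun setT f -> (forall x, `|f x| <= M) ->
  measurable_fun setT g -> (forall x, `|g x| <= M) ->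
  (\int[nu j]_x (g x)%:E = 0)%E ->
  (\int[P]_w (f (Y i w) * g (Y j w))%:E = 0)%E.
Proof.
move=> ij mf fM mg gM g0.
pose h (z : R * R) := f z.1 * g z.2.
have mh : measurable_fun setT h.
  by apply: measurable_funM; apply: measurableT_comp.
have hM z : `|h z| <= M ^+ 2 by rewrite normrM expr2 ler_pM.
have mphi : measurable_fun setT (fun w => (Y i w, Y j w)).
  exact: measurable_fun_pair.
transitivity (\int[nu i \x nu j]_z (h z)%:E)%E.
  rewrite (@eq_measure_integral _ _ _ setT (pushforward P (fun w => (Y i w, Y j w)))).
    rewrite (@integral_pushforward _ _ _ _ _ _ _ P setT (EFin \o h)) //.
      exact/measurable_EFinP.
    apply: (@bounded_integrable _ _ _ _ (h \o (fun w => (Y i w, Y j w))) (M ^+ 2)) => //.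
      exact: measurableT_comp.
    by move=> w; exact: hM.
  by move=> A mA _; exact: joint_law_prod.
rewrite -(@integral12_prod_meas1 _ _ _ _ _ _ _ (EFin \o h)); last first.
  exact: (@bounded_integrable _ _ _ _ _ (M ^+ 2)).
rewrite /fubini_F integral0_eq // => x _ /=.
under eq_integral => y _ do rewrite /h EFinM /=.
rewrite integralZl // ?g0 ?mule0 //.
exact: (@bounded_integrable _ _ _ (nu j) g M).
Qed.

(** Expanding the square, the cross terms vanish by independence and each of the [n] diagonal terms
    is at most 1. *)
Lemma second_moment_sum (f : nat -> R -> R) n :
  (forall i, measurable_fun setT (f i)) -> (forall i x, `|f i x| <= 1) ->
  (forall i, \int[nu i]_x (f i x)%:E = 0)%E ->
  (\int[P]_w ((\sum_(i < n) f i (Y i w)) ^+ 2)%:E <= n%:R%:E)%E.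
Proof.
move=> mf f1 f0.
have mfY i : measurable_fun setT (fun w => f i (Y i w)).
  exact: measurableT_comp.
have intff i j : P.-integrable setT (fun w => (f i (Y i w) * f j (Y j w))%:E).
  apply: (@bounded_integrable _ _ _ _ (fun w => f i (Y i w) * f j (Y j w)) 1).
    exact: measurable_funM.
  by move=> w; rewrite normrM mulr_ile1.
have -> : (\int[P]_w ((\sum_(i < n) f i (Y i w)) ^+ 2)%:E =
    \int[P]_w \sum_(i < n) \sum_(j < n) (f i (Y i w) * f j (Y j w))%:E)%E.
  apply: eq_integral => w _; rewrite expr2 mulr_suml -sumEFin.
  by apply: eq_bigr => i _; rewrite mulr_sumr -sumEFin.
rewrite integral_sum //; last by move=> i; apply: integrable_sum.
rewrite [leRHS](_ : _ = \sum_(i < n) 1%E)%E; last first.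
  by rewrite sumEFin sumr_const card_ord.
apply: lee_sum => i _; rewrite integral_sum // (bigD1 i) //= big1 ?adde0.
  apply: (@le_trans _ _ (\int[P]_w 1%E)%E).
    apply: ge0_le_integral => //.
    - by move=> w _; rewrite lee_fin -expr2 sqr_ge0.
    - exact/measurable_EFinP/measurable_funM.
    - move=> w _; rewrite lee_fin; apply: (le_trans (ler_norm _)).
      by rewrite normrM mulr_ile1.
  by rewrite integral_cst // mul1e; exact: probability_le1.
by move=> j ji; apply: (@integral_indep_prod i j _ _ 1) => //; rewrite eq_sym.
Qed.

Lemma chebyshev_sum (f : nat -> R -> R) n (a : R) : 0 < a ->
  (forall i, measurable_fun setT (f i)) -> (forall i x, `|f i x| <= 1) ->
  (forall i, \int[nu i]_x (f i x)%:E = 0)%E ->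
  (P [set w | (a <= `|\sum_(i < n) f i (Y i w)|)%R] <= (n%:R / a ^+ 2)%:E)%E.
Proof.
move=> a0 mf f1 f0.
pose S w := \sum_(i < n) f i (Y i w).
have mS : measurable_fun setT S.
  by apply: measurable_sum => i; exact: measurableT_comp.
pose X : {mfun T >-> R} := HB.pack S (isMeasurableFun.Build _ _ _ _ _ mS).
have a20 : 0 < a ^+ 2 by rewrite exprn_gt0.
have := @markov _ _ _ P X (fun x => x ^+ 2) a a0 (exprn_measurable 2).
have h1 : forall r : R, 0 <= r -> 0 <= r ^+ 2 by move=> r _; exact: sqr_ge0.
have h2 : {in Num.nneg &, {homo (fun x : R => x ^+ 2) : x y / x <= y}}.
  by move=> x y; rewrite !nnegrE => x0 y0 xy; rewrite ler_sqr.
move=> /(_ h1 h2); rewrite unlock /=.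
under eq_integral do rewrite real_normK ?num_real //.
move=> /le_trans /(_ (second_moment_sum n mf f1 f0)).
rewrite EFinM -lee_pdivlMl // => /le_trans; apply.
by rewrite muleC.
Qed.

End independent_sums.

(** * Limits superior, centring, and eventually small events *)

Lemma limn_esup_lt_bound (R : realType) (u : (\bar R)^nat) (l : \bar R) :
  (limn_esup u < l)%E ->
  exists2 r : R, (r%:E < l)%E & \forall n \near \oo, (u n <= r%:E)%E.
Proof.
rewrite /limn_esup limf_esupE => /ereal_inf_lt[_ [V Voo <-]] Vl.
have near_le (r : R) : (ereal_sup (u @` V) <= r%:E)%E ->
    \forall n \near \oo, (u n <= r%:E)%E.
  move=> Vr; apply: filterS Voo => n Vn; apply: le_trans Vr.
  by apply: ereal_sup_ubound; exists n.
(* The tail supremum may be [-oo]; any real below [l] then serves as the bound. *)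
case: (ereal_sup _) Vl near_le => [r rl near_le|yl _|ltl near_le].
  by exists r => //; exact: near_le.
  by move: yl; rewrite ltNge leey.
case: l ltl => [s _|_|//].
  by exists (s - 1); [rewrite lte_fin; lra|apply: near_le; exact: leNye].
by exists 0; [rewrite ltry|apply: near_le; exact: leNye].
Qed.

(** The measure lives on the whole line while the moments are integrals over the unit interval.
    Cutting [g - e] to zero outside it bounds the function everywhere, and the mean is zero because
    the interval has full mass. *)
Lemma centered_restriction (R : realType) (mu : probability R R) (g : R -> R) :
  mu `[0, 1]%classic = 1%E -> measurable_fun setT g ->
  (forall x, 0 <= x <= 1 -> 0 <= g x <= 1) ->
  let e := \int[mu]_(x in `[0, 1]%classic) g x in
  let f := (fun x => g x - e) \_ `[0, 1]%classic in
  [/\ measurable_fun setT f, forall x, `|f x| <= 1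
    & (\int[mu]_x (f x)%:E = 0)%E].
Proof.
move=> mu1 mg g01 e f.
have mI : measurable (`[0, 1]%classic : set R) by exact: measurable_itv.
have gI x : `[0, 1]%classic x -> 0 <= g x <= 1.
  by move=> /=; rewrite in_itv /=; exact: g01.
have ig : mu.-integrable `[0, 1]%classic (EFin \o g).
  apply: measurable_bounded_integrable => //.
  - by apply: le_lt_trans (ltry 1); exact: probability_le1.
  - exact: measurable_funTS.
  - exists 1; split; first exact: num_real.
    move=> x x1 y /gI /andP[g0 g1]; rewrite /= ger0_norm //.
    exact: (le_trans g1 (ltW x1)).
have ic r : mu.-integrable `[0, 1]%classic (EFin \o cst r).
  apply: measurable_bounded_integrable => //; first by apply: le_lt_trans (ltry 1); exact: probability_le1.
  exists `|r|; split; first exact: num_real.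
  by move=> x rx y _; exact: ltW.
have cstE r : \int[mu]_(x in `[0, 1]%classic) cst r x = r.
  by rewrite Rintegral_cst // (_ : fine _ = 1) ?mulr1 // -[RHS]/(fine 1%E) -mu1.
have e0 : 0 <= e by apply: Rintegral_ge0 => x /gI /andP[].
have e1 : e <= 1.
  rewrite -[leRHS]cstE; apply: le_Rintegral => // x /gI /andP[] //.
split.
- apply/(measurable_restrictT _ _).1 => //.
  by apply: measurable_funTS; exact: measurable_funB.
- move=> x; rewrite /f patchE; case: ifPn => [|_]; last by rewrite normr0.
  by rewrite inE => /gI /andP[g0 g1]; rewrite ler_norml; lra.
- pose I : set R := `[0, 1]%classic.
  transitivity (\int[mu]_(x in I) ((g x)%:E - (cst e x)%:E))%E.
    rewrite [RHS]integral_mkcond; apply: eq_integral => x _.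
    by rewrite /f !patchE; case: ifP.
  rewrite integralB //; last exact: (ic e).
  have fing : (\int[mu]_(x in I) (g x)%:E)%E = e%:E.
    by rewrite /e /Rintegral fineK //; exact: integrable_fin_num.
  rewrite fing; have -> : (\int[mu]_(x in I) (cst e x)%:E)%E = e%:E.
    by rewrite -[in RHS](cstE e) /Rintegral fineK //; apply: integrable_fin_num => //; exact: ic.
  by rewrite subee.
Qed.

(** [A] lies in the increasing union over [N] of the intersections of [D k] for [k >= N]. Each of
    these has measure at most [e], hence so does the union, by continuity from below. Intersecting
    over [e = 1 / (j + 1)] gives a measurable null set containing [A], which itself need not be
    measurable. *)
Lemma negligible_eventually_small d (T : measurableType d) (R : realType)
    (P : probability T R) (A : set T) :
  (forall e : R, 0 < e -> exists D : nat -> set T,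
     [/\ forall k, measurable (D k), \forall k \near \oo, (P (D k) <= e%:E)%E
       & forall w, A w -> \forall k \near \oo, D k w]) ->
  P.-negligible A.
Proof.
move=> AD.
have /choice[D DP] : forall j : nat, exists D : nat -> set T,
     [/\ forall k, measurable (D k),
         \forall k \near \oo, (P (D k) <= (j.+1%:R^-1 : R)%:E)%E
       & forall w, A w -> \forall k \near \oo, D k w].
  by move=> j; apply: AD; rewrite invr_gt0.
pose G j N := \bigcap_(k in [set k | (N <= k)%N]) D j k.
have mG j N : measurable (G j N).
  by apply: bigcap_measurable => [|k _]; [exists N => /=|have [] := DP j].
have mUG j : measurable (\bigcup_N G j N) by exact: bigcup_measurable.
have PUG j : (P (\bigcup_N G j N) <= (j.+1%:R^-1 : R)%:E)%E.
  have ndG : nondecreasing_seq (G j).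
    move=> N N' NN'; apply/subsetPset => w Gw k /= N'k; apply: Gw => /=.
    exact: leq_trans N'k.
  have cvgG := @nondecreasing_cvg_mu _ _ _ P _ (mG j) (mUG j) ndG.
  rewrite -(cvg_lim _ cvgG) //; apply: lime_le; first exact: cvgP cvgG.
  apply: nearW => N /=; have [mD [N0 _ PD] _] := DP j.
  apply: le_trans (PD (maxn N N0) _); last by rewrite /= leq_maxr.
  apply: le_measure; rewrite ?inE //.
  by move=> w; apply; rewrite /= leq_maxl.
exists (\bigcap_j \bigcup_N G j N); split.
- by apply: bigcap_measurable => // j _.
- apply/eqP; rewrite eq_le measure_ge0 andbT; apply/lee_addgt0Pr => e e0.
  rewrite add0e; have [N _ /(_ N)] := near_infty_natSinv_lt (PosNum e0).
  move=> /(_ (leqnn N)) /= Ne; apply: (@le_trans _ _ (N.+1%:R^-1 : R)%:E); last first.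
    by rewrite lee_fin ltW.
  apply: le_trans (PUG N); apply: le_measure; rewrite ?inE //.
    exact: bigcap_measurable.
  by move=> w; apply.
- move=> w Aw j _; have [_ _ /(_ w Aw)[N _ DN]] := DP j.
  by exists N => // k /= Nk; exact: DN.
Qed.

(* mu = prod_i nu_i is realized as the joint law of independent Y_i ~ nu_i;
   mu(C_I) = 0 becomes: the event {(Y_i)_i in C_I} is P-negligible. *)
Theorem theorem4 (R : realType) (nu : nat -> probability R R)
  (d : measure_display) (T : measurableType d) (P : probability T R)
  (Y : nat -> T -> R) :
  (forall i, nu i `[0, 1]%classic = 1%E) ->
  (forall i, measurable_fun setT (Y i)) ->
  (forall i B, measurable B -> P (Y i @^-1` B) = nu i B) ->
  mutually_independent P Y ->
  let m i := \int[nu i]_(x in `[0, 1]%classic) x in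
  let m2 i := \int[nu i]_(x in `[0, 1]%classic) (x ^+ 2) in
  let eps1 i := fine (nu i [set 1]) in
  let sigmaT n := Num.sqrt (\sum_(i < n) \int[nu i]_(x in `[0, 1]%classic) ((x - m i) ^+ 2)) in
  (limn_esup (fun n => ((Num.sqrt n%:R)^-1 * \sum_(i < n) (m i - 2^-1))%:E) < +oo)%E ->
  (0 < limn_einf (fun n => ((n%:R)^-1 * \sum_(i < n) (m i - m2 i))%:E))%E ->
  (limn_esup (fun n => ((n%:R)^-1 * \sum_(i < n) eps1 i)%:E) < (2^-1)%:E)%E ->
  sigmaT @ \oo --> +oo ->
  P.-negligible [set w | (fun i => Y i w) \in @CJP R].

Proof.
move=> nu01 mY lawY indY m m2 eps1 sigmaT hmean hvar _ _.
have [K0 _ [N1 _ meanN]] := limn_esup_lt_bound hmean.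
(* The lower limit is minus the upper limit of the negated sequence, so the same lemma applies with
   [l = 0]. *)
have [c0 c0lt [N2 _ varN]] : exists2 r : R, (r%:E < 0)%E & \forall n \near \oo,
    ((- ((n%:R)^-1 * \sum_(i < n) (m i - m2 i)))%:E <= r%:E)%E.
  by apply: limn_esup_lt_bound; rewrite -oppe_gt0.
rewrite lte_fin in c0lt.
(* Halving leaves room for fluctuations: the expected sum of [Y i * (1 - Y i)] is at least
   [2 * c * n], and a loss below [c * n] is allowed. *)
pose K := Num.max K0 0; pose c := - c0 / 2.
have K_ge0 : 0 <= K by rewrite le_max lexx orbT.
have c_gt0 : 0 < c by rewrite /c; lra.
have mean_le n : (N1 <= n)%N -> (0 < n)%N ->
    \sum_(i < n) (m i - 2^-1) <= K * Num.sqrt n%:R.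
  move=> /meanN /= + n0; rewrite lee_fin => le_K0.
  rewrite -ler_pdivrMr ?sqrtr_gt0 ?ltr0n // mulrC (le_trans le_K0) //.
  by rewrite le_max lexx.
have var_ge n : (N2 <= n)%N -> (0 < n)%N ->
    2 * c * n%:R <= \sum_(i < n) (m i - m2 i).
  move=> /varN /= + n0; rewrite lee_fin => le_c0.
  rewrite -ler_pdivlMr ?ltr0n // mulrC; move: le_c0; rewrite /c; lra.
clearbody c K.
pose I : set R := `[0, 1]%classic.
pose f i := (fun x => x - m i) \_ I.
have fP i := centered_restriction (nu01 i) (@measurable_id _ R setT) (fun x h => h).
pose v (x : R) := x - x ^+ 2.
pose e i := \int[nu i]_(x in I) v x.
pose g i := (fun x => v x - e i) \_ I.
have mv : measurable_fun setT v.
  by apply: measurable_funB => //; exact: exprn_measurable.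
have v01 x : 0 <= x <= 1 -> 0 <= v x <= 1.
  by move=> /andP[x0 x1]; rewrite /v; apply/andP; split; nra.
have gP i := centered_restriction (nu01 i) mv v01.
have mI : measurable I by exact: measurable_itv.
have eE i : e i = m i - m2 i.
  have intI (h : R -> R) : measurable_fun setT h ->
      (forall x, 0 <= x <= 1 -> `|h x| <= 1) ->
      (nu i).-integrable I (EFin \o h).
    move=> mh h1; apply: measurable_bounded_integrable => //.
    - by apply: le_lt_trans (ltry 1); exact: probability_le1.
    - exact: measurable_funTS.
    - exists 1; split; first exact: num_real.
      move=> x x1 y Iy /=; apply: le_trans (ltW x1); apply: h1.
      by move: Iy; rewrite /I /= in_itv.
  apply: RintegralB => //; apply: intI => //.
  - by move=> x /andP[x0 x1]; rewrite ger0_norm.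
  - by move=> x /andP[x0 x1]; rewrite ger0_norm ?sqr_ge0 // expr_le1.
apply: negligible_eventually_small => eps eps0.
(* Chebyshev bounds the probability of [D1 k] by [1 / M ^ 2], at most [eps / 2] because
   [2 / eps <= M <= M ^ 2]. *)
pose M := 1 + 2 / eps.
have M1 : 1 <= M by rewrite lerDl divr_ge0 // ltW.
pose n k := (2 * k).+1.
pose D1 k := [set w | (M * Num.sqrt (n k)%:R <= `|\sum_(i < n k) f i (Y i w)|)%R].
pose D2 k := [set w | (c * (n k)%:R <= `|\sum_(i < n k) g i (Y i w)|)%R].
have mD (h : nat -> R -> R) (a : R) l : (forall i, measurable_fun setT (h i)) ->
    measurable [set w | (a <= `|\sum_(i < l) h i (Y i w)|)%R].
  move=> mh; rewrite -[X in measurable X]setTI; apply: measurable_fun_le => //.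
  apply: measurableT_comp => //; apply: measurable_sum => i.
  exact: measurableT_comp.
have mf i : measurable_fun setT (f i) by have [] := fP i.
have mg i : measurable_fun setT (g i) by have [] := gP i.
exists (fun k => D1 k `|` D2 k); split.
- by move=> k; apply: measurableU; exact: mD.
(* For [D2 k] Chebyshev gives [1 / (c ^ 2 * n k)], at most [eps / 2] from this threshold on, as
   [k <= n k]. *)
- have [N3 _ N3P] : \forall k \near \oo, 2 / (eps * c ^+ 2) <= k%:R :> R.
    exact: nbhs_infty_ger.
  exists N3 => // k /= N3k.
  have n0 : 0 < (n k)%:R :> R by rewrite ltr0n.
  have r0 : 0 < Num.sqrt (n k)%:R :> R by rewrite sqrtr_gt0.
  have rr : Num.sqrt (n k)%:R ^+ 2 = (n k)%:R :> R by rewrite sqr_sqrtr // ltW.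
  have Mr0 : 0 < M * Num.sqrt (n k)%:R by rewrite mulr_gt0 //; lra.
  have cn0 : 0 < c * (n k)%:R by rewrite mulr_gt0.
  apply: (le_trans (measureU2 _ _ _)); [exact: mD|exact: mD|].
  have -> : eps%:E = ((eps / 2)%:E + (eps / 2)%:E)%E.
    by rewrite -EFinD; congr EFin; field.
  apply: leeD.
  + apply: (le_trans (chebyshev_sum mY lawY indY (n k) Mr0 mf _ _)).
    * by move=> i; have [] := fP i.
    * by move=> i; have [] := fP i.
    rewrite lee_fin exprMn rr invfM mulrCA divff ?gt_eqF // mulr1.
    rewrite -[leRHS]invrK lef_pV2 ?posrE ?invr_gt0 ?divr_gt0 ?exprn_gt0 //; last lra.
    rewrite invf_div; apply: (@le_trans _ _ M); first by rewrite /M; lra.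
    by rewrite expr2 ler_peMr //; lra.
  + apply: (le_trans (chebyshev_sum mY lawY indY (n k) cn0 mg _ _)).
    * by move=> i; have [] := gP i.
    * by move=> i; have [] := gP i.
    have kn : k%:R <= (n k)%:R :> R by rewrite ler_nat /n mul2n -addnn leqW ?leq_addr.
    have := le_trans (N3P _ N3k) kn.
    rewrite ler_pdivrMr ?mulr_gt0 ?exprn_gt0 // => le2.
    rewrite lee_fin ler_pdivrMr ?exprn_gt0 //.
    by move: (ler_wpM2l (ltW n0) le2); rewrite exprMn; lra.
- move=> w /=; rewrite inE => -[p01 majto1].
  (* This is the [t] of [maj_prob_bounded_away] with [M + K] in place of [K]: off [D1 k] the random
     sum exceeds its mean by less than [M * sqrt (n k)]. *)
  pose t := (M + K + 2) / c.
  pose delta := (2 * expR (t ^+ 2))^-1.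
  have delta0 : 0 < delta by rewrite invr_gt0 mulr_gt0 ?expR_gt0.
  have [N3 _ N3P] : \forall k \near \oo, t ^+ 2 <= k%:R :> R.
    exact: nbhs_infty_ger.
  have near_maj : \forall k \near \oo, 1 - delta < maj_prob (fun i => Y i w) (n k).
    by apply: (cvgr_gt _ majto1); lra.
  have [N4 _ N4P] := near_maj.
  exists (N1 + N2 + N3 + N4)%N => // k /= Nk.
  have kn : (k <= n k)%N by rewrite /n mul2n -addnn leqW ?leq_addr.
  have [N1k N2k N3k N4k] : [/\ N1 <= n k, N2 <= n k, N3 <= k & N4 <= k]%N.
    by split; lia.
  apply: contrapT => /not_orP[/negP + /negP]; rewrite -!ltNge => ltM ltc.
  (* Membership in [CJP] includes values in the unit interval, so at this [w] the cut-off functions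
     agree with the uncut ones. *)
  have YI i : Y i w \in I by rewrite inE /I /= in_itv /= p01.
  have sumf : \sum_(i < n k) f i (Y i w) = \sum_(i < n k) (Y i w - m i).
    by apply: eq_bigr => i _; rewrite /f patchE YI.
  have sumg : \sum_(i < n k) g i (Y i w) =
      \sum_(i < n k) (Y i w * (1 - Y i w)) - \sum_(i < n k) (m i - m2 i).
    rewrite -sumrB; apply: eq_bigr => i _; rewrite /g patchE YI -eE /v; ring.
  have := N4P k N4k; rewrite /= ltNge => /negP; apply.
  apply: (@maj_prob_bounded_away _ _ _ c (M + K)) => //; first lra.
  + rewrite -(ler_pXn2r (_ : 0 < 2)%N) ?nnegrE ?sqrtr_ge0 ?divr_ge0 //; try lra.
    rewrite sqr_sqrtr //; apply: (le_trans (N3P _ N3k)).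
    by rewrite ler_nat.
  + have -> : \sum_(i < n k) (Y i w - 2^-1) =
        \sum_(i < n k) (Y i w - m i) + \sum_(i < n k) (m i - 2^-1).
      by rewrite -big_split; apply: eq_bigr => i _ /=; ring.
    rewrite mulrDl lerD ?mean_le // -sumf.
    exact/ltW/ltr_normlW.
  + have := var_ge _ N2k isT; move: ltc; rewrite sumg ltr_norml => /andP[]; lra.
Qed.
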